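(* Let $n\ge 3$ and let $\mathcal{P}$ be a set of $n$ points in the real plane $\mathbb{R}^2$, not all on one line. Then there is a point $P\in\mathcal{P}$ such that $d(P)\ge \lceil n/3\rceil+1$.
   Context: $\mathcal{L}(\mathcal{P})$ is the set of lines determined by $\mathcal{P}$, i.e. the lines in the plane containing at least two points of $\mathcal{P}$. For $P\in\mathcal{P}$, $d(P)$ (the incident-line-number of $P$) is the number of lines of $\mathcal{L}(\mathcal{P})$ that pass through $P$. $\lceil x\rceil$ is the smallest integer greater than or equal to $x$. *)

(* Defs.v *)
From HB Require Import structures.
From mathcomp Require Import all_boot all_order all_algebra.
Set Implicit Arguments. Unset Strict Implicit. Unset Printing Implicit Defensive.
Import Order.TTheory GRing.Theory Num.Theory.
Local Open Scope ring_scope.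

Section Lines.
Variable R : realFieldType.

Definition point := (R * R)%type.

(* A line {(x,y) | a x + b y = c} with (a,b) <> (0,0), in canonical
   normalized form: (1, b/a, c/a) if a <> 0, else (0, 1, c/b). *)
Definition normalize_line (l : R * R * R) : R * R * R :=
  let: (a, b, c) := l in
  if a != 0 then (1, b / a, c / a) else (0, 1, c / b).

Definition line_through (A B : point) : R * R * R :=
  let a := B.2 - A.2 in
  let b := A.1 - B.1 in
  normalize_line (a, b, a * A.1 + b * A.2).

Definition on_line (P : point) (l : R * R * R) : bool :=
  let: (a, b, c) := l in a * P.1 + b * P.2 == c.

Definition lines_of (pts : seq point) : seq (R * R * R) :=
  undup [seq line_through p.1 p.2 |
           p <- [seq (A, B) | A <- pts, B <- pts] & p.1 != p.2].

Definition incident_line_number (pts : seq point) (P : point) : nat :=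
  count (on_line P) (lines_of pts).

Definition all_collinear (pts : seq point) : Prop :=
  exists a b c : R, (a != 0 \/ b != 0) /\
    forall P, P \in pts -> a * P.1 + b * P.2 = c.

End Lines.

(* Main.v *)
From Stdlib Require Import Classical.
Require Import Defs.
From HB Require Import structures.
From mathcomp Require Import all_boot all_order all_algebra.
From mathcomp Require Import realalg complex ring lra zify.

(** Let [v_i = (x_i, y_i, 1)] and [d_ijk = |det (v_i, v_j, v_k)|^2].  Weights
    [w_i > 0] define a random triple of points, with probability proportional
    to [w_i w_j w_k d_ijk].  If no line contains more than [2n/3] points, the
    weights can be chosen so that every point lies in the triple with almost
    the same probability [3/n]: lowering the weight of a point which is too
    likely decreases [p^n / (\prod w_i)^3], [p] being the total mass, by a
    constant factor, and this potential is bounded away from [0].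

    Let [X] be the number of points of the triple on a line with [r] points.
    Then [X <= 2], and [E X (X - 1) <= (E X)^2 / 2], because the generating
    function of [X] is the determinant of a pencil of positive semidefinite
    Hermitian forms, hence has real roots.  Since [E X] is about [3r/n] and the
    numbers [E X (X - 1)] of all lines add up to [6], the sum of [r^2] over the
    lines is at least [4n^2/3].  As the sum of [r (r - 1)] is [n (n - 1)], the
    sum of the [d(P)] is at least [n (n + 3) / 3], which is Langer's inequality.
    If a line contains more than [2n/3] points, any point off it will do.

    Lowering the potential terminates only over an archimedean field, so the
    configuration is first moved to the complex algebraic numbers by a ring
    morphism which preserves both collinearity and non-collinearity. *)

Set Implicit Arguments. Unset Strict Implicit. Unset Printing Implicit Defensive.
Import Order.TTheory GRing.Theory Num.Theory.
Local Open Scope ring_scope.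

(** * Specialization of configurations *)

(** All equations holding under [psi] persist under [phi], but only one inequation is kept; finitely
    many are handled through the product of the elements concerned. *)
Definition specializable (K : fieldType) (C : closedFieldType) (A : idomainType) :=
  forall (psi : {rmorphism A -> K}) (a : A), psi a != 0 ->
  exists2 phi : {rmorphism A -> C},
    forall b, psi b = 0 -> phi b = 0 & phi a != 0.

Lemma specializable_int (K : numFieldType) (C : numClosedFieldType) :
  specializable K C int.
Proof.
move=> psi a; have psiE z : psi z = z%:~R by rewrite -[z in LHS]intz rmorph_int.
rewrite psiE intr_eq0 => a0.
exists (intmul 1 : {rmorphism int -> C}) => [b|] /=; last by rewrite intr_eq0.
by move/eqP; rewrite psiE intr_eq0 => /eqP ->; rewrite mulr0z.
Qed.

Lemma size_sub_lead (A : nzRingType) (F : {poly A}) : F != 0 ->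
  (size (F - lead_coef F *: 'X^((size F).-1))%R < size F)%N.
Proof.
rewrite -size_poly_gt0 => F0; rewrite -[X in (_ < X)%N](prednK F0) ltnS.
apply/leq_sizeP => j; rewrite leq_eqVlt coefB coefZ coefXn => /orP[/eqP <-|lj].
  by rewrite eqxx mulr1 subrr.
by rewrite gtn_eqF // mulr0 subr0 nth_default // -(prednK F0).
Qed.

(* [G] plays the role of a minimal polynomial of [psi 'X]: minimality of its
   size replaces irreducibility over the fraction field. *)
Lemma inverse_modulo_minimal (K : fieldType) (A : idomainType)
    (psi : {rmorphism {poly A} -> K}) (G : {poly A}) :
  psi G = 0 -> psi (lead_coef G)%:P != 0 ->
  (forall H : {poly A}, psi H = 0 -> (size H < size G)%N ->
     forall i, psi (H`_i)%:P = 0) ->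
  forall F : {poly A}, psi F != 0 ->
  exists (U V R : {poly A}) (e : A),
    [/\ U * F + V * G + R = e%:P, psi e%:P != 0 & forall i, psi (R`_i)%:P = 0].
Proof.
move=> psiG psic minG F; have [m] := ubnP (size F).
pose ker (H : {poly A}) := forall i, psi (H`_i)%:P = 0.
have kerM H H' : ker H -> ker (H' * H).
  move=> kH i; rewrite coefM !rmorph_sum big1 // => j _.
  by rewrite !rmorphM /= kH mulr0.
have psiZ (b : A) (H : {poly A}) : psi (b *: H) = psi b%:P * psi H.
  by rewrite -mul_polyC rmorphM.
elim: m F => // m IH F; rewrite ltnS => sF psiF.
have F0 : F != 0 by apply: contraNneq psiF => ->; rewrite rmorph0.
have G0 : G != 0 by apply: contraNneq psic => ->; rewrite lead_coef0 rmorph0.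
have [sGF|sFG] := leqP (size G) (size F).
  have := Pdiv.ComRing.rdivp_eq G F.
  set q := Pdiv.CommonRing.rdivp _ _; set r := Pdiv.CommonRing.rmodp _ _.
  set k := Pdiv.CommonRing.rscalp _ _ => FE.
  have sr : (size r < size G)%N by apply: Pdiv.CommonRing.ltn_rmodpN0.
  have rE : r = lead_coef G ^+ k *: F - q * G by rewrite FE addrC addKr.
  have psir : psi r != 0.
    by rewrite rE rmorphB rmorphM /= psiG mulr0 subr0 psiZ !rmorphXn mulf_neq0 ?expf_neq0.
  have [|U [V [R [e [UVR e0 kR]]]]] := IH r _ psir.
    exact: leq_trans sr (leq_trans sGF sF).
  exists (U * (lead_coef G ^+ k)%:P), (V - U * q), R, e; split=> //.
  by rewrite -UVR rE -mul_polyC; ring.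
have [lF0|lF0] := eqVneq (psi (lead_coef F)%:P) 0.
  pose F1 := F - lead_coef F *: 'X^((size F).-1).
  have sF1 : (size F1 < size F)%N by apply: size_sub_lead.
  have psiF1 : psi F1 != 0 by rewrite rmorphB /= psiZ lF0 mul0r subr0.
  have [|U [V [R [e [UVR e0 kR]]]]] := IH F1 _ psiF1; first exact: leq_trans sF1 sF.
  exists U, V, (R - U * 'X^((size F).-1) * (lead_coef F)%:P), e; split=> //.
    by rewrite -UVR /F1 -mul_polyC; ring.
  move=> i; rewrite coefB !rmorphB /= kR sub0r kerM ?oppr0 // => j.
  by rewrite coefC; case: ifP => _; rewrite ?rmorph0.
have [sF1|sF1] := leqP (size F) 1.
  have FC := size1_polyC sF1.
  exists 1, 0, 0, (F`_0); split; rewrite -?FC //; first ring.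
  by move=> i; rewrite coef0 rmorph0.
have := Pdiv.ComRing.rdivp_eq F G.
set q := Pdiv.CommonRing.rdivp _ _; set r := Pdiv.CommonRing.rmodp _ _.
set k := Pdiv.CommonRing.rscalp _ _ => GE.
have sr : (size r < size F)%N by apply: Pdiv.CommonRing.ltn_rmodpN0.
have rE : r = lead_coef F ^+ k *: G - q * F by rewrite GE addrC addKr.
have [psir|psir] := eqVneq (psi r) 0; last first.
  have [|U [V [R [e [UVR e0 kR]]]]] := IH r _ psir; first exact: leq_trans sr sF.
  exists (- U * q), (V + U * (lead_coef F ^+ k)%:P), R, e; split=> //.
  by rewrite -UVR rE -mul_polyC; ring.
(* If the remainder is killed, so is [q]. By minimality of [G] all coefficients of [q] and [r] are
   killed, and the top coefficient of [GE] contradicts the survival of both leading coefficients. *)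
have psiq : psi q = 0.
  have : psi (q * F) = 0.
    by rewrite -[q * F](addrK r) -GE rmorphB /= psir psiZ psiG mulr0 subr0.
  by rewrite rmorphM /= => /eqP; rewrite mulf_eq0 (negPf psiF) orbF => /eqP.
have lF1 : lead_coef F ^+ k != 0 by rewrite expf_neq0 ?lead_coef_eq0.
have sq : (size q < size G)%N.
  have [->|q0] := eqVneq q 0; first by rewrite size_poly0 size_poly_gt0.
  have : (size (q * F)%R <= size G)%N.
    rewrite -[q * F](addrK r) -GE (leq_trans (size_polyD _ _)) // geq_max size_polyN.
    by rewrite size_scale // leqnn ltnW // (ltn_trans sr sFG).
  rewrite size_mul //; case: (size F) sF1 => [|[|f]] // _.
  by rewrite !addnS; apply: leq_trans; rewrite ltnS leq_addr.
case/eqP: psic.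
have : psi ((lead_coef F ^+ k *: G)`_(size G).-1)%:P = 0.
  rewrite GE coefD !rmorphD /= (minG r) // ?(ltn_trans sr) // addr0 mulrC.
  by apply: kerM; apply: minG.
rewrite coefZ !rmorphM /= !rmorphXn /= => /eqP.
by rewrite mulf_eq0 expf_eq0 (negPf lF0) andbF => /eqP.
Qed.

(** If every polynomial killed by [psi] has all its coefficients killed, ['X] behaves like a
    transcendental and may go to any non-root of the image of [F]. Otherwise it goes to a root of
    the image of a smallest annihilator [G], and pseudo-division by [G] controls the kernel. *)
Lemma specializable_poly (K : fieldType) (C : closedFieldType) (A : idomainType) :
  specializable K C A -> specializable K C {poly A}.
Proof.
move=> spA psi F psiF.
pose psi0 : {rmorphism A -> K} := psi \o polyC.
have psiZ b (H : {poly A}) : psi (b *: H) = psi0 b * psi H.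
  by rewrite -mul_polyC rmorphM.
have psiE (H : {poly A}) : (forall i, psi0 H`_i = 0) -> psi H = 0.
  by move=> H0; rewrite -[H]coefK poly_def rmorph_sum big1 // => i _; rewrite psiZ H0 mul0r.
pose ext (phi : {rmorphism A -> C}) (y : C) : {rmorphism {poly A} -> C} :=
  horner_morph (fun a => mulrC y (phi a)).
have extE phi y H : ext phi y H = (map_poly phi H).[y] by [].
have map0 (phi : {rmorphism A -> C}) (H : {poly A}) :
    (forall b, psi0 b = 0 -> phi b = 0) -> (forall i, psi0 H`_i = 0) ->
    map_poly phi H = 0.
  by move=> kphi H0; apply/polyP => i; rewrite coef_map coef0; apply: kphi; exact: H0.
pose annihilator m := exists H : {poly A},
  [/\ psi H = 0, size H = m & exists i, psi0 H`_i != 0].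
case: (classic (exists m, annihilator m)) => [[m0 am0]|transc]; last first.
  have [i Fi] : exists i, psi0 F`_i != 0.
    apply: NNPP => nF; case/eqP: psiF; apply: psiE => i.
    by apply/eqP/negPn/negP => Fi; apply: nF; exists i.
  have [phi kphi phiF] := spA psi0 _ Fi.
  have mF : map_poly phi F != 0.
    by apply: contraNneq phiF => mF; rewrite -coef_map mF coef0.
  have [y yF] := closed_nonrootP _ mF.
  exists (ext phi y) => [H psiH|]; last by rewrite extE.
  rewrite extE map0 ?horner0 // => j; apply/eqP/negPn/negP => Hj.
  by apply: transc; exists (size H), H; split=> //; exists j.
have [m [G [psiG sG [i0 Gi0]]] minm] :
    exists2 m, annihilator m & forall m', (m' < m)%N -> ~ annihilator m'.
  elim/ltn_ind: m0 am0 => m0 IH am0.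
  case: (classic (exists2 m', (m' < m0)%N & annihilator m')) => [[m' lt am']|no].
    exact: IH lt am'.
  by exists m0 => // m' lt am'; apply: no; exists m'.
have minG (H : {poly A}) : psi H = 0 -> (size H < size G)%N ->
    forall i, psi0 H`_i = 0.
  move=> psiH; rewrite sG => /minm nH i; apply/eqP/negPn/negP => Hi.
  by apply: nH; exists H; split=> //; exists i.
have G0 : G != 0 by apply: contraNneq Gi0 => ->; rewrite coef0 rmorph0.
have psic : psi0 (lead_coef G) != 0.
  apply: contraNneq Gi0 => lG0.
  pose G1 := G - lead_coef G *: 'X^((size G).-1).
  have sG1 : (size G1 < size G)%N by apply: size_sub_lead.
  have psiG1 : psi G1 = 0 by rewrite rmorphB /= psiZ psiG lG0 mul0r subr0.
  have -> : G = G1 + lead_coef G *: 'X^((size G).-1) by rewrite subrK.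
  by rewrite coefD rmorphD coefZ rmorphM lG0 mul0r addr0; apply/eqP/minG.
have [U [V [R [e [UVR psie kR]]]]] := inverse_modulo_minimal psiG psic minG psiF.
(* Survival of the leading coefficient gives [G] a root and lets pseudo-division by [G] be
   cancelled; survival of [e] prevents [F] from vanishing, by the relation [UVR]. *)
have psice : psi0 (lead_coef G * e) != 0 by rewrite rmorphM mulf_neq0.
have [phi kphi] := spA psi0 _ psice; rewrite rmorphM mulf_eq0 negb_or => /andP[phic phie].
have smG : size (map_poly phi G) = size G by rewrite size_map_poly_id0.
have sG1 : (1 < size G)%N.
  rewrite ltnNge; apply/negP => /size1_polyC GC; case/eqP: psic.
  by rewrite GC lead_coefC /= -GC.
have [y] : exists y, root (map_poly phi G) y.
  by apply/closed_rootP; rewrite smG gtn_eqF.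
rewrite rootE => /eqP Gy.
have kext H : psi H = 0 -> ext phi y H = 0.
  move=> psiH; have := Pdiv.ComRing.rdivp_eq G H.
  set q := Pdiv.CommonRing.rdivp _ _; set r := Pdiv.CommonRing.rmodp _ _.
  set k := Pdiv.CommonRing.rscalp _ _ => HE.
  have sr : (size r < size G)%N by apply: Pdiv.CommonRing.ltn_rmodpN0.
  have psir : psi r = 0.
    have -> : r = (lead_coef G ^+ k)%:P * H - q * G.
      by rewrite mul_polyC HE addrC addKr.
    by rewrite rmorphB !rmorphM /= psiH psiG !mulr0 subr0.
  have : ext phi y ((lead_coef G ^+ k)%:P * H) = 0.
    rewrite mul_polyC HE rmorphD rmorphM /= extE [X in _ + X]extE.
    by rewrite extE Gy mulr0 map0 ?horner0 ?addr0 //; apply: minG.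
  have eC : ext phi y (lead_coef G ^+ k)%:P = phi (lead_coef G) ^+ k.
    by rewrite extE map_polyC hornerC; exact: rmorphXn.
  rewrite rmorphM eC => /eqP.
  by rewrite mulf_eq0 expf_eq0 (negPf phic) andbF => /eqP.
exists (ext phi y) => //; apply: contraNneq phie => Fy.
have <- : ext phi y (U * F + V * G + R) = phi e by rewrite UVR extE map_polyC hornerC.
have R0 : ext phi y R = 0 by rewrite extE map0 ?horner0.
by rewrite !rmorphD !rmorphM Fy (kext _ psiG) R0 !mulr0 !addr0.
Qed.

(** The ring is an iterated polynomial ring over the integers, with one variable for each entry of
    [s], evaluated at that entry. *)
Lemma exists_specializable (K : numFieldType) (C : numClosedFieldType) (s : seq K) :
  exists A : idomainType, specializable K C A /\
    exists psi : {rmorphism A -> K}, forall x, x \in s -> exists a, psi a = x.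
Proof.
elim: s => [|x s [A [spA [psi psis]]]].
  exists int; split; first exact: specializable_int.
  by exists (intmul 1 : {rmorphism int -> K}).
exists {poly A}; split; first exact: specializable_poly.
exists (horner_morph (fun a => mulrC x (psi a)) : {rmorphism _ -> _}) => y.
rewrite inE => /orP[/eqP ->|/psis[a <-]].
  by exists 'X; rewrite /= horner_morphX.
by exists a%:P; rewrite /= horner_morphC.
Qed.

(** * Determinants of triples and transfer of a configuration *)

Definition det3 (R : comPzRingType) (I : Type) (x y z : I -> R) (i j k : I) : R :=
  x i * (y j * z k - y k * z j) - y i * (x j * z k - x k * z j)
  + z i * (x j * y k - x k * y j).

Lemma det3_morph (R S : comPzRingType) (f : {rmorphism R -> S}) (I : Type)
    (x y z : I -> R) i j k :
  f (det3 x y z i j k) = det3 (f \o x) (f \o y) (f \o z) i j k.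
Proof. by rewrite /det3 !(rmorphD, rmorphN, rmorphM). Qed.

Lemma specialize_configuration (K : numFieldType) (C : numClosedFieldType)
    (I : finType) (x y : I -> K) :
  exists X Y : I -> C, forall i j k,
    (det3 X Y (fun=> 1) i j k == 0) = (det3 x y (fun=> 1) i j k == 0).
Proof.
have [A [spA [psi psis]]] := exists_specializable C (codom x ++ codom y).
have lift (z : I -> K) : {subset codom z <= codom x ++ codom y} ->
    exists Z : I -> A, forall i, psi (Z i) = z i.
  move=> sz; suff /fin_all_exists [Z ZE] : forall i, exists a, psi a = z i by exists Z.
  by move=> i; apply/psis/sz/codom_f.
have [|x' x'E] := lift x; first by move=> u ux; rewrite mem_cat ux.
have [|y' y'E] := lift y; first by move=> u uy; rewrite mem_cat uy orbT.
pose D i j k := det3 x' y' (fun=> 1) i j k.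
have DE i j k : psi (D i j k) = det3 x y (fun=> 1) i j k.
  by rewrite det3_morph /det3 /= !x'E !y'E !rmorph1.
(* Keeping this single product nonzero keeps every non-collinear triple non-collinear. *)
pose a := \prod_i \prod_j \prod_(k | psi (D i j k) != 0) D i j k.
have psia : psi a != 0.
  rewrite rmorph_prod prodf_seq_neq0; apply/allP => i _ /=.
  rewrite rmorph_prod prodf_seq_neq0; apply/allP => j _ /=.
  by rewrite rmorph_prod prodf_seq_neq0; apply/allP => k _; apply/implyP.
have [phi kphi phia] := spA psi a psia.
exists (phi \o x'), (phi \o y') => i j k.
have <- : phi (D i j k) = det3 (phi \o x') (phi \o y') (fun=> 1) i j k.
  by rewrite det3_morph /det3 /= !rmorph1.
rewrite -DE; have [/kphi ->|D0] := eqVneq (psi (D i j k)) 0; first by rewrite eqxx.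
apply/negbTE; apply: contraNneq phia => phiD.
by rewrite /a !rmorph_prod (bigD1 i) //= rmorph_prod (bigD1 j) //= rmorph_prod
  (bigD1 k) //= phiD !mul0r.
Qed.

(** * Balanced weights on triples *)

Definition triple_weight (R : comPzRingType) (I : Type) (d : I -> I -> I -> R)
  (w : I -> R) (i j k : I) : R := w i * w j * w k * d i j k.

Definition total (R : comPzRingType) (I : finType) (d : I -> I -> I -> R)
  (w : I -> R) : R := \sum_i \sum_j \sum_k triple_weight d w i j k.

Definition marginal (R : comPzRingType) (I : finType) (d : I -> I -> I -> R)
  (w : I -> R) (i : I) : R := \sum_j \sum_k triple_weight d w i j k.

(** What remains of an alternating form after passing to squared absolute values. *)
Definition sym_alternating (R : comPzRingType) (I : Type) (d : I -> I -> I -> R) :=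
  [/\ forall i j k, d i j k = d j i k, forall i j k, d i j k = d i k j
    & forall i k, d i i k = 0].

(** The line through [a] and [b] as a set of indices; for [a = b] and [d] as above it degenerates to
    all of [I]. *)
Definition coline (R : comPzRingType) (I : Type) (d : I -> I -> I -> R) (a b : I) : pred I :=
  fun k => d a b k == 0.

Lemma in_coline (R : comPzRingType) (I : Type) (d : I -> I -> I -> R) (a b k : I) :
  (k \in coline d a b) = coline d a b k.
Proof. by []. Qed.

Lemma coline_ends (R : comPzRingType) (I : Type) (d : I -> I -> I -> R) i j :
  sym_alternating d -> coline d i j i /\ coline d i j j.
Proof.
move=> [dC1 dC2 d0]; split; rewrite /coline /=.
  by rewrite dC2 d0.
by rewrite dC1 dC2 d0.
Qed.

Lemma card_coline (R : comPzRingType) (I : finType) (d : I -> I -> I -> R) i j :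
  sym_alternating d -> i != j -> (2 <= #|coline d i j|)%N.
Proof.
move=> altd ij; have [iL jL] := coline_ends i j altd.
have <- : #|pred2 i j| = 2%N by rewrite card2 ij.
by apply/subset_leq_card/subsetP => k /pred2P[] ->.
Qed.

Lemma sum_eq_delta (R : comPzRingType) (I : finType) (f : I -> R) i :
  \sum_a f a * (a == i)%:R = f i.
Proof.
rewrite (bigD1 i) //= eqxx mulr1 big1 ?addr0 // => a /negbTE ->.
by rewrite mulr0.
Qed.

(** As [d] vanishes on repeated indices, [total] is affine in each single weight; the three
    positions that [i] can take contribute one [marginal] each. *)
Lemma total_shrink (R : comPzRingType) (I : finType) (d : I -> I -> I -> R)
    (w : I -> R) (t : R) (i : I) : sym_alternating d ->
  total d (fun a => w a * (1 - t * (a == i)%:R)) = total d w - t * (marginal d w i *+ 3).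
Proof.
move=> [dC1 dC2 d0]; set T := triple_weight d w.
have TC1 a b c : T a b c = T b a c by rewrite /T /triple_weight dC1; ring.
have TC2 a b c : T a b c = T a c b by rewrite /T /triple_weight dC2; ring.
have E a b c : triple_weight d (fun a => w a * (1 - t * (a == i)%:R)) a b c =
    T a b c - t * (T a b c * (a == i)%:R + T a b c * (b == i)%:R + T a b c * (c == i)%:R).
  have z1 b' : d i b' i = 0 by rewrite dC2 d0.
  have z2 a' : d a' i i = 0 by rewrite dC1 z1.
  rewrite /T /triple_weight.
  have [->|ai] := eqVneq a i; have [->|bi] := eqVneq b i; have [->|ci] := eqVneq c i;
    rewrite ?d0 ?z1 ?z2 /=; ring.
rewrite /total; under eq_bigr do under eq_bigr do under eq_bigr do rewrite E.
under eq_bigr do under eq_bigr do rewrite sumrB -mulr_sumr !big_split /=.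
under eq_bigr do rewrite sumrB -mulr_sumr !big_split /=.
rewrite sumrB -mulr_sumr !big_split /= -/(total d w); congr (_ - t * _).
have -> : \sum_a \sum_b \sum_c T a b c * (a == i)%:R = marginal d w i.
  under eq_bigr do under eq_bigr do rewrite -mulr_suml.
  by under eq_bigr do rewrite -mulr_suml; rewrite sum_eq_delta.
have -> : \sum_a \sum_b \sum_c T a b c * (b == i)%:R = marginal d w i.
  under eq_bigr do under eq_bigr do rewrite -mulr_suml.
  under eq_bigr do rewrite sum_eq_delta.
  by under eq_bigr do under eq_bigr do rewrite TC1.
have -> : \sum_a \sum_b \sum_c T a b c * (c == i)%:R = marginal d w i.
  under eq_bigr do under eq_bigr do rewrite sum_eq_delta.
  by under eq_bigr do under eq_bigr do rewrite TC2 TC1.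
by ring.
Qed.

Lemma bernoulli (R : realFieldType) (y : R) n : 0 <= y -> 1 + n%:R * y <= (1 + y) ^+ n.
Proof.
move=> y0; elim: n => [|n IH]; first by rewrite mul0r addr0 expr0.
rewrite exprS; apply: le_trans (ler_wpM2l _ IH); last by rewrite addr_ge0.
rewrite -natr1 -subr_ge0.
have -> : (1 + y) * (1 + n%:R * y) - (1 + (n%:R + 1) * y) = n%:R * y ^+ 2 by ring.
by rewrite mulr_ge0 // sqr_ge0.
Qed.

(** [marginal d w i *+ 3] divided by [total d w] is the probability that [i] lies in the triple.
    While some index exceeds the bound, shrinking its weight improves the potential by the factor
    [1 + c], and the capacity hypothesis stops this. *)
Lemma exists_balanced_weight (R : archiRealFieldType) (I : finType)
    (d : I -> I -> I -> R) (delta e : R) :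
  sym_alternating d -> (forall i j k, 0 <= d i j k) -> 0 < delta -> 0 < e ->
  (forall w, (forall i, 0 < w i) -> delta * \prod_i w i ^+ 3 <= total d w ^+ #|I|) ->
  exists2 w : I -> R, forall i, 0 < w i &
    forall i, #|I|%:R * (marginal d w i *+ 3) <= (3 + e) * total d w.
Proof.
move=> altd d_ge0 delta0 e0 cap; set n := #|I|.
pose balanced w := [forall i, n%:R * (marginal d w i *+ 3) <= (3 + e) * total d w].
(* With this [t], the product [(1 + (3 + e) * t) * (1 - 3 * t)] is exactly [1 + c]. *)
pose t := e / (18 + 6 * e); pose c := e * t / 2.
have t0 : 0 < t by rewrite divr_gt0 //; lra.
have t6 : t < 1 / 6 by rewrite ltr_pdivrMr; lra.
have c0 : 0 < c by rewrite divr_gt0 // mulr_gt0.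
pose M := total d (fun=> 1) ^+ n.
have tot_ge0 w : (forall i, 0 < w i) -> 0 <= total d w.
  move=> w0; do 3!apply: sumr_ge0 => ? _.
  by rewrite /triple_weight !mulr_ge0 // ltW.
suff [N HN] : exists N, forall w, (forall i, 0 < w i) ->
    ~ total d w ^+ n * (1 + c) ^+ N <= M * \prod_i w i ^+ 3.
  have [//|none] : (exists2 w : I -> R, forall i, 0 < w i & forall i,
      n%:R * (marginal d w i *+ 3) <= (3 + e) * total d w) \/
      exists2 w : I -> R, forall i, 0 < w i &
        total d w ^+ n * (1 + c) ^+ N <= M * \prod_i w i ^+ 3.
    elim: N {HN} => [|N [good|[w w0 wN]]].
    - right; exists (fun=> 1); first by move=> _; exact: ltr01.
      by rewrite expr0 !mulr1 big1 ?mulr1 // => i _; rewrite expr1n.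
    - by left.
    have [/forallP good|] := boolP (balanced w); first by left; exists w.
    case/forallPn=> i; rewrite -ltNge => unb.
    right; pose w' a := w a * (1 - t * (a == i)%:R).
    have w'0 a : 0 < w' a.
      by rewrite mulr_gt0 //; case: (a == i); rewrite ?mulr1 ?mulr0; lra.
    exists w' => //.
    have prod_w' : \prod_a w' a ^+ 3 = (1 - t) ^+ 3 * \prod_a w a ^+ 3.
      rewrite (bigD1 i) //= [in RHS](bigD1 i) //= {1}/w' eqxx mulr1 exprMn.
      rewrite (eq_bigr (fun a => w a ^+ 3)) => [|a /negbTE ai]; first by ring.
      by rewrite /w' ai mulr0 subr0 mulr1.
    have T0 : 0 < total d w.
      rewrite lt_def tot_ge0 // andbT; apply: contraTneq (cap _ w0) => ->.
      have nF : (#|I| == 0)%N = false.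
        by apply/negbTE; rewrite -lt0n; apply/card_gt0P; exists i.
      rewrite expr0n nF -ltNge.
      by rewrite mulr_gt0 // prodr_gt0 // => a _; rewrite exprn_gt0.
    have := tot_ge0 _ w'0; have := total_shrink w t i altd; rewrite -/w'.
    set T := total d w in unb T0 wN *; set m := marginal d w i *+ 3 in unb *.
    (* [y] is the fraction of the total mass lost in the step. *)
    pose y := m * t / T => totE tot'0.
    have m0 : 0 < m.
      have : 0 < n%:R * m by apply: lt_trans _ unb; rewrite mulr_gt0 //; lra.
      by rewrite pmulr_rgt0 // ltr0n; apply/card_gt0P; exists i.
    have y0 : 0 <= y by apply: divr_ge0; [apply: mulr_ge0|]; apply: ltW.
    have tot'E : total d w' = T * (1 - y).
      by rewrite totE mulrBr mulr1 /y mulrCA divff ?gt_eqF // mulr1 mulrC.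
    have y1 : 0 <= 1 - y by rewrite tot'E pmulr_rge0 in tot'0.
    have ny : (3 + e) * t <= n%:R * y.
      rewrite /y mulrA ler_pdivlMr // mulrA mulrAC [leRHS]mulrC.
      by rewrite [leLHS]mulrC ler_pM2l // ltW.
    (* The gain of one step: the power of the total drops by [(1 - y) ^+ n], which Bernoulli bounds
       by the inverse of [1 + n * y], while the product of cubes drops only by [(1 - t) ^+ 3]. *)
    have key : (1 + c) * (1 - y) ^+ n <= (1 - t) ^+ 3.
      have h1 : (1 + n%:R * y) * (1 - y) ^+ n <= 1.
        apply: (@le_trans _ _ ((1 + y) ^+ n * (1 - y) ^+ n)).
          by rewrite ler_wpM2r ?exprn_ge0 // bernoulli.
        rewrite -exprMn exprn_ile1 //; first by rewrite mulr_ge0 // addr_ge0.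
        by rewrite -subr_ge0 (_ : _ - _ = y ^+ 2) ?sqr_ge0 //; ring.
      have h2 : 1 + c <= (1 + n%:R * y) * (1 - t) ^+ 3.
        apply: (@le_trans _ _ ((1 + (3 + e) * t) * (1 - 3 * t))).
          have tE : t * (18 + 6 * e) = e by rewrite divfK //; lra.
          rewrite /c -subr_ge0.
          have -> : (1 + (3 + e) * t) * (1 - 3 * t) - (1 + e * t / 2) =
            t * (e - t * (18 + 6 * e)) / 2 by field.
          by rewrite tE subrr mulr0 mul0r.
        apply: ler_pM; [| lra | lra |].
          by rewrite addr_ge0 // mulr_ge0 ?ltW //; lra.
        rewrite -subr_ge0 (_ : _ - _ = t ^+ 2 * (3 - t)); last ring.
        by rewrite mulr_ge0 ?sqr_ge0 //; lra.
      have n1 : 0 < (1 - t) ^+ 3 by rewrite exprn_gt0; lra.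
      apply: (@le_trans _ _ ((1 + n%:R * y) * (1 - t) ^+ 3 * (1 - y) ^+ n)).
        by rewrite ler_wpM2r // exprn_ge0.
      by rewrite mulrAC -[leRHS]mul1r ler_wpM2r // ltW.
    rewrite tot'E exprMn prod_w' exprS.
    rewrite (_ : _ * _ = (T ^+ n * (1 + c) ^+ N) * ((1 + c) * (1 - y) ^+ n)); last ring.
    rewrite [leRHS]mulrCA [leRHS]mulrC; apply: ler_pM => //.
    - by rewrite mulr_ge0 // exprn_ge0 // ?ltW //; lra.
    by apply: mulr_ge0; [lra | apply: exprn_ge0].
  by case: none => w w0 /(HN w w0).
(* For this [N0], Bernoulli gives [delta * (1 + c) ^+ N0 >= delta + M], more than the potential
   allows. *)
have [N0 _ /ltW] : exists2 N0, True & M / (delta * c) < N0%:R.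
  exists (Num.bound (M / (delta * c))) => //; apply: archi_boundP.
  apply: divr_ge0; last by rewrite ltW // mulr_gt0.
  by apply: exprn_ge0; apply: tot_ge0 => _; exact: ltr01.
have dc0 : 0 < delta * c by apply: mulr_gt0.
rewrite ler_pdivrMr // => MN.
exists N0 => w w0 h; have P0 : 0 < \prod_i w i ^+ 3.
  by rewrite prodr_gt0 // => i _; rewrite exprn_gt0.
have : delta * (1 + c) ^+ N0 * \prod_i w i ^+ 3 <= M * \prod_i w i ^+ 3.
  apply: le_trans h; rewrite mulrAC ler_pM2r ?cap //.
  by rewrite exprn_gt0 // addr_gt0.
rewrite ler_pM2r // => h1.
have := bernoulli N0 (ltW c0).
rewrite -(ler_pM2l delta0) => h2; have := le_trans h2 h1.
rewrite mulrDr mulr1 mulrCA => h3; move: MN h3 delta0; lra.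
Qed.

Lemma exists_max (R : realFieldType) (I : finType) (P : pred I) (w : I -> R) i0 :
  P i0 -> exists2 i, P i & forall j, P j -> w j <= w i.
Proof. by move=> Pi0; case: (Order.TotalTheory.arg_maxP w Pi0) => i Pi iM; exists i. Qed.

Lemma total_ge (R : realFieldType) (I : finType) (d : I -> I -> I -> R) (w : I -> R)
    (a b c : I) : (forall i j k, 0 <= d i j k) -> (forall i, 0 < w i) ->
  triple_weight d w a b c <= total d w.
Proof.
move=> d0 w0; have T0 i j k : 0 <= triple_weight d w i j k.
  by rewrite /triple_weight !mulr_ge0 // ltW.
rewrite /total (bigD1 a) //= (bigD1 b) //= (bigD1 c) //= -!addrA lerDl.
by rewrite !addr_ge0 //; do ?[apply: sumr_ge0 => ? _].
Qed.

(** After cubing, [z] has [p = 2n - 3l] factors too many and [x] has [q = n - 3] too few. Replacing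
    [z ^+ p] by [y ^+ p], and then the surplus [y ^+ q] by [x ^+ q], only increases the product. *)
Lemma power_balance (R : realFieldType) (x y z : R) (l n : nat) :
  0 < z -> z <= y -> y <= x -> (2 <= l)%N -> (3 <= n)%N -> (3 * l <= 2 * n)%N ->
  (x * y ^+ l.-1 * z ^+ (n - l)) ^+ 3 <= (x * y * z) ^+ n.
Proof.
move=> z0 zy yx l2 n3 ln.
have y0 := lt_le_trans z0 zy; have x0 := lt_le_trans y0 yx.
pose p := (2 * n - 3 * l)%N; pose q := (n - 3)%N.
have zE : (z ^+ (n - l)) ^+ 3 = z ^+ n * z ^+ p.
  by rewrite -exprM -exprD; have -> : ((n - l) * 3 = n + p)%N by rewrite /p; lia.
have yE : (y ^+ l.-1) ^+ 3 * y ^+ p = y ^+ n * y ^+ q.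
  by rewrite -exprM -!exprD; have -> : (l.-1 * 3 + p = n + q)%N by rewrite /p /q; lia.
have xE : x ^+ 3 * x ^+ q = x ^+ n.
  by rewrite -exprD; have -> : (3 + q = n)%N by rewrite /q; lia.
have zyp : z ^+ p <= y ^+ p by apply: lerXn2r => //; rewrite nnegrE ltW.
have yxq : y ^+ q <= x ^+ q by apply: lerXn2r => //; rewrite nnegrE ltW.
rewrite !exprMn zE -xE.
have X0 : 0 < x ^+ 3 by rewrite exprn_gt0.
have Y0 : 0 < (y ^+ l.-1) ^+ 3 by rewrite !exprn_gt0.
have Y1 : 0 < y ^+ n by rewrite exprn_gt0.
have Z0 : 0 < z ^+ n by rewrite exprn_gt0.
move: X0 Y0 Y1 Z0 zyp yxq yE.
move: (x ^+ 3) (x ^+ q) ((y ^+ l.-1) ^+ 3) (y ^+ p) (y ^+ n) (y ^+ q) (z ^+ n) (z ^+ p).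
move=> X3 Xq Yl Yp Yn Yq Zn Zp X0 Y0 Y1 Z0 zyp yxq yE.
apply: (@le_trans _ _ (X3 * (Yl * Yp) * Zn)).
  rewrite [leLHS](_ : _ = X3 * Yl * Zn * Zp); last ring.
  rewrite [leRHS](_ : _ = X3 * Yl * Zn * Yp); last ring.
  by rewrite ler_pM2l // !mulr_gt0.
rewrite yE [leLHS](_ : _ = X3 * Yn * Zn * Yq); last ring.
rewrite [leRHS](_ : _ = X3 * Yn * Zn * Xq); last ring.
by rewrite ler_pM2l // !mulr_gt0.
Qed.

(** Greedy choice of a basis: [a] is heaviest, [b] heaviest among the others, [c] heaviest off their
    line. This one triple bounds the total from below; the remaining weights are at most [w b] on
    the line and [w c] off it, so [power_balance] applies. *)
Lemma total_capacity (R : realFieldType) (I : finType) (d : I -> I -> I -> R) :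
  sym_alternating d -> (forall i j k, 0 <= d i j k) -> (3 <= #|I|)%N ->
  (forall a b, a != b -> (3 * #|coline d a b| <= 2 * #|I|)%N) ->
  exists2 delta, 0 < delta & forall w, (forall i, 0 < w i) ->
    delta * \prod_i w i ^+ 3 <= total d w ^+ #|I|.
Proof.
move=> altd d_ge0 n3 few; set n := #|I| in n3 few *.
(* Every nonzero [d i j k] is at least [(1 + S)^-1]; zero values add nothing to [S], since the
   inverse of 0 is 0. *)
pose S := \sum_i \sum_j \sum_k (d i j k)^-1.
have S0 : 0 <= S by do 3!apply: sumr_ge0 => ? _; rewrite invr_ge0.
have S1 : 0 < 1 + S by lra.
exists ((1 + S)^-1 ^+ n) => [|w w0]; first by rewrite exprn_gt0 // invr_gt0.
have [i0 _] : exists i0 : I, i0 \in I by apply/card_gt0P; apply: leq_trans n3.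
have [a _ aM] := @exists_max _ I predT w i0 isT.
have [b ba bM] : exists2 b, b != a & forall j, j != a -> w j <= w b.
  have [b0 b0a] : exists b0, b0 \in predC1 a.
    by apply/card_gt0P; rewrite cardC1 -/n; move: n3; case: (n) => [|[]].
  exact: exists_max b0a.
pose L := coline d a b; pose l := #|L|.
have lb : (3 * l <= 2 * n)%N by apply: few; rewrite eq_sym.
have [c cL cM] : exists2 c, c \notin L & forall j, j \notin L -> w j <= w c.
  have [c0 c0L] : exists c0, c0 \in predC L.
    apply/card_gt0P; rewrite -(ltn_add2l l) addn0 (cardC L) -/n.
    by move: lb n3; clearbody l n; lia.
  exact: (@exists_max _ _ (fun c => c \notin L) w c0).
have [aL bL] : a \in L /\ b \in L := coline_ends a b altd.
have l2 : (2 <= l)%N by apply: card_coline; rewrite // eq_sym.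
have wca : w c <= w b.
  by apply: bM; apply: contraNneq cL => ->.
have wba := aM b isT.
have tc : (1 + S)^-1 * (w a * w b * w c) <= total d w.
  apply: le_trans (total_ge a b c d_ge0 w0); rewrite /triple_weight mulrC.
  apply: ler_wpM2l; first by rewrite !mulr_ge0 ?ltW.
  have dabc : 0 < d a b c by rewrite lt_def d_ge0 andbT; exact: cL.
  rewrite -[leRHS]invrK lef_pV2 ?posrE ?invr_gt0 //.
  have T0 i j k : 0 <= (d i j k)^-1 by rewrite invr_ge0.
  apply: ler_wpDl; first exact: ler01.
  rewrite /S (bigD1 a) //= (bigD1 b) //= (bigD1 c) //= -!addrA lerDl.
  by rewrite !addr_ge0 //; do ?[apply: sumr_ge0 => ? _].
apply: (@le_trans _ _ (((1 + S)^-1 * (w a * w b * w c)) ^+ n)); last first.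
  have X0 : 0 <= (1 + S)^-1 * (w a * w b * w c).
    by rewrite mulr_ge0 ?invr_ge0 ?mulr_ge0 ?ltW.
  by apply: lerXn2r => //; rewrite nnegrE //; apply: le_trans tc.
rewrite exprMn ler_pM2l ?exprn_gt0 ?invr_gt0 //.
rewrite prodrXl.
have PE : \prod_i w i <= w a * w b ^+ l.-1 * w c ^+ (n - l).
  rewrite (bigID (mem L)) /= (bigD1 a) //=.
  have -> : l.-1 = #|[pred i | (i \in L) && (i != a)]|.
    rewrite /l (cardD1 a) aL; apply: eq_card => i; rewrite !inE andbC //.
  have -> : (n - l)%N = #|[pred i | i \notin L]|.
    by rewrite /n -(cardC L) addKn; apply: eq_card => i; rewrite !inE.
  rewrite -!prodr_const; apply: ler_pM.
  - by rewrite mulr_ge0 ?prodr_ge0 // => *; rewrite ltW.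
  - by rewrite prodr_ge0 // => *; rewrite ltW.
  - rewrite ler_pM2l //; apply: ler_prod => i /andP[_ ia].
    by rewrite ltW //= bM.
  by apply: ler_prod => i iL; rewrite ltW //= cM.
apply: (@le_trans _ _ ((w a * w b ^+ l.-1 * w c ^+ (n - l)) ^+ 3)).
  by rewrite ler_pXn2r // ?nnegrE ?mulr_ge0 ?prodr_ge0 ?exprn_ge0 ?ltW // => *; rewrite ltW.
exact: power_balance.
Qed.

(** * The inequality for one line *)

(* Rows and columns are numbered 0, 1, 2; [mixed_disc S S S] is 6 times the
   determinant of [S]. *)
Definition mixed_cofactor (R : comPzRingType) (A B : nat -> nat -> R)
    (a1 a2 b1 b2 : nat) : R :=
  A a1 b1 * B a2 b2 - A a1 b2 * B a2 b1 - A a2 b1 * B a1 b2 + A a2 b2 * B a1 b1.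

Definition mixed_disc (R : comPzRingType) (A B G : nat -> nat -> R) : R :=
  mixed_cofactor A B 1 2 1 2 * G 0 0 + mixed_cofactor A B 1 2 2 0 * G 0 1
  + mixed_cofactor A B 1 2 0 1 * G 0 2 + mixed_cofactor A B 2 0 1 2 * G 1 0
  + mixed_cofactor A B 2 0 2 0 * G 1 1 + mixed_cofactor A B 2 0 0 1 * G 1 2
  + mixed_cofactor A B 0 1 1 2 * G 2 0 + mixed_cofactor A B 0 1 2 0 * G 2 1
  + mixed_cofactor A B 0 1 0 1 * G 2 2.

Lemma mixed_disc_rot (R : comPzRingType) (A B G : nat -> nat -> R) :
  mixed_disc A B G = mixed_disc B G A.
Proof. by rewrite /mixed_disc /mixed_cofactor; ring. Qed.

Lemma mixed_disc_sum (R : comPzRingType) (I : finType) (A B : nat -> nat -> R)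
    (G : I -> nat -> nat -> R) :
  \sum_i mixed_disc A B (G i) = mixed_disc A B (fun a b => \sum_i G i a b).
Proof. by rewrite /mixed_disc !mulr_sumr -!big_split. Qed.

Definition coords (R : Type) (I : Type) (x y z : I -> R) (i : I) (a : nat) : R :=
  match a with 0%N => x i | 1%N => y i | _ => z i end.

(** The second family is separate so that it can be the complex conjugate of the first. *)
Definition gram (R : comPzRingType) (I : finType) (w : I -> R)
  (f g : I -> nat -> R) (a b : nat) : R := \sum_i w i * f i a * g i b.

(** A polarized Cauchy-Binet formula: trilinearity reduces it to Gram matrices of rank one, where it
    is a polynomial identity. *)
Lemma cauchy_binet3 (R : comPzRingType) (I : finType) (u v w : I -> R)
    (x y z x' y' z' : I -> R) :
  \sum_i \sum_j \sum_k u i * v j * w k * (det3 x y z i j k * det3 x' y' z' i j k) =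
  mixed_disc (gram u (coords x y z) (coords x' y' z'))
    (gram v (coords x y z) (coords x' y' z')) (gram w (coords x y z) (coords x' y' z')).
Proof.
rewrite /gram mixed_disc_rot -mixed_disc_sum; apply: eq_bigr => i _.
rewrite -mixed_disc_rot mixed_disc_rot mixed_disc_rot -mixed_disc_sum.
apply: eq_bigr => j _; rewrite mixed_disc_rot -mixed_disc_sum.
apply: eq_bigr => k _.
by rewrite /mixed_disc /mixed_cofactor /det3 /=; ring.
Qed.

(** Let [S] and [M] be the Gram matrices of all points and of those in [L], and [p], [a], [b] the
    three sums. Then 6 times the determinant of [S + s M] is [p + 3 a s + 3 b s^2], as the third row
    of [M] is zero; the claim is that its discriminant is nonnegative. *)
Lemma hermitian_line_ineq (C : numClosedFieldType) (I : finType) (L : pred I)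
    (w x y z : I -> C) :
  (forall i, 0 <= w i) -> (forall i, L i -> z i = 0) ->
  forall T : I -> I -> I -> C,
  (forall i j k, T i j k = w i * w j * w k * (det3 x y z i j k * (det3 x y z i j k)^*)) ->
  4 * (\sum_i \sum_j \sum_k T i j k) * (\sum_(i | L i) \sum_(j | L j) \sum_k T i j k)
  <= 3 * (\sum_(i | L i) \sum_j \sum_k T i j k) ^+ 2.
Proof.
move=> w0 zL T TE.
have T0 i j k : 0 <= T i j k by rewrite TE mulr_ge0 ?mul_conjC_ge0 ?mulr_ge0.
pose wL i := w i * (L i)%:R.
set p := (X in 4 * X); set b := (X in 4 * p * X); set a := (X in 3 * X ^+ 2).
have b0 : 0 <= b by do 3!apply: sumr_ge0 => ? _.
have a0 : 0 <= a by do 3!apply: sumr_ge0 => ? _.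
have [->|bN0] := eqVneq b 0; first by rewrite mulr0 mulr_ge0 ?exprn_ge0.
have conj3 i j k : (det3 x y z i j k)^* =
    det3 (fun i => (x i)^*) (fun i => (y i)^*) (fun i => (z i)^*) i j k.
  by rewrite /det3 !(rmorphD, rmorphN, rmorphM).
pose F := coords x y z.
pose G := coords (fun i => (x i)^*) (fun i => (y i)^*) (fun i => (z i)^*).
pose S := gram w F G; pose M := gram wL F G.
have pE : p = mixed_disc S S S.
  by rewrite -cauchy_binet3; do 3!apply: eq_bigr => ? _; rewrite TE conj3.
have aE : a = mixed_disc M S S.
  rewrite -cauchy_binet3 /a big_mkcond; apply: eq_bigr => i _; rewrite /wL.
  case: (L i); last first.
    by rewrite big1 // => j _; rewrite big1 // => k _; rewrite mulr0 !mul0r.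
  by do 2!apply: eq_bigr => ? _; rewrite TE conj3 mulr1.
have bE : b = mixed_disc M M S.
  rewrite -cauchy_binet3 /b big_mkcond; apply: eq_bigr => i _; rewrite /wL.
  case: (L i); last first.
    by rewrite big1 // => j _; rewrite big1 // => k _; rewrite mulr0 !mul0r.
  rewrite big_mkcond; apply: eq_bigr => j _.
  case: (L j); last by rewrite big1 // => k _; rewrite !mulr0 !mul0r.
  by apply: eq_bigr => k _; rewrite TE conj3 !mulr1.
have w_conj i : (w i)^* = w i by rewrite geC0_conj.
have Sconj i j : (S i j)^* = S j i.
  rewrite rmorph_sum; apply: eq_bigr => k _; rewrite !rmorphM /= w_conj mulrAC.
  by congr (_ * _ * _); case: i => [|[|i]]; case: j => [|[|j]] //=; rewrite conjCK.
have Mconj i j : (M i j)^* = M j i.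
  rewrite rmorph_sum; apply: eq_bigr => k _; rewrite !rmorphM /= w_conj rmorph_nat mulrAC.
  by congr (_ * _ * _); case: i => [|[|i]]; case: j => [|[|j]] //=; rewrite conjCK.
have ML i : M i 2%N = 0.
  rewrite /M /gram big1 // => k _; rewrite /wL /G /=.
  by case Lk: (L k); rewrite ?mulr0 ?mul0r // zL // conjC0 mulr0.
have ML' j : M 2%N j = 0 by rewrite -Mconj ML conjC0.
have c0 : 0 <= S 2%N 2%N.
  by apply: sumr_ge0 => k _; rewrite -mulrA mulr_ge0 ?mul_conjC_ge0.
have m0 : 0 <= M 0%N 0%N.
  by apply: sumr_ge0 => k _; rewrite -mulrA mulr_ge0 ?mul_conjC_ge0 ?mulr_ge0 ?ler0n.
have := Sconj 0%N 1%N; have := Sconj 0%N 2%N; have := Sconj 1%N 2%N.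
have := Sconj 0%N 0%N; have := Sconj 1%N 1%N; have := Sconj 2%N 2%N.
have := Mconj 0%N 1%N; have := Mconj 0%N 0%N; have := Mconj 1%N 1%N.
move: pE aE bE c0 m0; rewrite /mixed_disc /mixed_cofactor !ML !ML'.
move: (S 0%N 0%N) (S 0%N 1%N) (S 0%N 2%N) (S 1%N 0%N) (S 1%N 1%N) (S 1%N 2%N)
  (S 2%N 0%N) (S 2%N 1%N) (S 2%N 2%N) => n1 s01 s02 s10 n2 s12 s20 s21 c.
move: (M 0%N 0%N) (M 0%N 1%N) (M 1%N 0%N) (M 1%N 1%N) => m1 u u' m2.
move=> pE aE bE c0 m0 m2r m1r u_conj cr n2r n1r c12 c02 c01.
(* Elimination of the third coordinate: [N1], [N2], [U], [U'] are [c] times the entries of the Schur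
   complement of [c] in [S]; [Q] is the determinant of the 2 by 2 block of [M], and [B] polarizes
   the two determinants. *)
pose Q := m1 * m2 - u * u'.
pose N1 := n1 * c - s02 * s20; pose N2 := n2 * c - s12 * s21.
pose U := s01 * c - s02 * s21; pose U' := s10 * c - s12 * s20.
pose B := m1 * N2 + m2 * N1 - u * U' - u' * U.
have bQ : b = 2 * c * Q by rewrite bE /Q; ring.
have cpos : 0 < c.
  by rewrite lt_def c0 andbT; apply: contraNneq bN0 => cz; rewrite bQ cz mulr0 mul0r.
have Q0 : 0 <= Q by rewrite bQ pmulr_rge0 ?mulr_gt0 ?ltr0n // in b0.
have QN0 : Q != 0 by apply: contraNneq bN0 => Qz; rewrite bQ Qz mulr0.
have m1pos : 0 < m1.
  rewrite lt_def m0 andbT; apply: contraNneq QN0 => m1z.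
  by rewrite eq_le Q0 /Q m1z mul0r sub0r -u_conj oppr_le0 mul_conjC_ge0.
(* Times [m1 ^+ 2], the difference is a positive multiple of the square of a real number plus
   [4 * Q] times a squared modulus. *)
rewrite -subr_ge0 -(pmulr_rge0 _ (exprn_gt0 2 m1pos)).
have -> : m1 ^+ 2 * (3 * a ^+ 2 - 4 * p * b) =
    12 * ((2 * Q * N1 - B * m1) ^+ 2 + 4 * Q * ((N1 * u - m1 * U) * (N1 * u' - m1 * U'))).
  by rewrite pE aE bE /B /Q /N1 /N2 /U /U'; ring.
have u'_conj : u'^* = u by rewrite -u_conj conjCK.
have c12' : s21^* = s12 by rewrite -c12 conjCK.
have c02' : s20^* = s02 by rewrite -c02 conjCK.
have c01' : s10^* = s01 by rewrite -c01 conjCK.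
rewrite mulr_ge0 ?ler0n // addr_ge0 //.
  suff e : (2 * Q * N1 - B * m1)^* = 2 * Q * N1 - B * m1.
    by rewrite expr2 -{2}e mul_conjC_ge0.
  rewrite /B /Q /N1 /N2 /U /U' !(rmorphD, rmorphB, rmorphN, rmorphM, rmorph_nat) /=.
  rewrite m1r m2r n1r n2r cr u_conj u'_conj c12 c02 c01 c12' c02' c01'; ring.
apply: mulr_ge0; first by rewrite mulr_ge0 ?ler0n.
have <- : (N1 * u - m1 * U)^* = N1 * u' - m1 * U'.
  rewrite /N1 /U !(rmorphD, rmorphB, rmorphN, rmorphM, rmorph_nat) /=.
  rewrite m1r n1r cr u_conj c02 c01 c12' c02' /U'; ring.
by rewrite mul_conjC_ge0.
Qed.

(** The argument of [Re] is already real; the real part only brings it into [R], where the weights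
    live. *)
Definition sqnorm_det3 (R : rcfType) (I : Type) (x y z : I -> R[i]) (i j k : I) : R :=
  complex.Re (det3 x y z i j k * (det3 x y z i j k)^*)%R.

Lemma sqnorm_det3E (R : rcfType) (I : Type) (x y z : I -> R[i]) (i j k : I) :
  ((sqnorm_det3 x y z i j k)%:C)%C = det3 x y z i j k * (det3 x y z i j k)^*.
Proof. by rewrite RRe_real // ger0_real // mul_conjC_ge0. Qed.

Lemma sqnorm_det3_ge0 (R : rcfType) (I : Type) (x y z : I -> R[i]) (i j k : I) :
  0 <= sqnorm_det3 x y z i j k.
Proof. by rewrite -ler0c sqnorm_det3E mul_conjC_ge0. Qed.

Lemma sqnorm_det3_eq0 (R : rcfType) (I : Type) (x y z : I -> R[i]) (i j k : I) :
  (sqnorm_det3 x y z i j k == 0) = (det3 x y z i j k == 0).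
Proof. by rewrite -mul_conjC_eq0 -sqnorm_det3E -(inj_eq (@complexI R)). Qed.

Lemma sqnorm_det3_alternating (R : rcfType) (I : Type) (x y z : I -> R[i]) :
  sym_alternating (sqnorm_det3 x y z).
Proof.
split=> [i j k|i j k|i k]; rewrite /sqnorm_det3.
- have -> : det3 x y z i j k = - det3 x y z j i k by rewrite /det3; ring.
  by rewrite rmorphN mulrNN.
- have -> : det3 x y z i j k = - det3 x y z i k j by rewrite /det3; ring.
  by rewrite rmorphN mulrNN.
by have -> : det3 x y z i i k = 0 by [rewrite /det3; ring]; rewrite mul0r.
Qed.

(** By Cramer's rule the new coordinates are those in the basis [a], [b], [c], scaled by its
    determinant; the factor is the determinant of a 3 by 3 adjugate. *)
Lemma det3_change_basis (R : comPzRingType) (I : Type) (x y z : I -> R) (a b c i j k : I) :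
  det3 (fun l => det3 x y z l b c) (fun l => det3 x y z a l c) (fun l => det3 x y z a b l)
    i j k = det3 x y z a b c ^+ 2 * det3 x y z i j k.
Proof. by rewrite /det3; ring. Qed.

(** In the basis [a], [b], [c] the third coordinate vanishes on the line through [a] and [b]. All
    triple weights are multiplied by one positive factor, and both sides are quadratic in them. *)
Lemma line_ineq (R : rcfType) (I : finType) (x y z : I -> R[i]) (w : I -> R) (a b c : I) :
  (forall i, 0 <= w i) -> det3 x y z a b c != 0 ->
  4 * total (sqnorm_det3 x y z) w *
    (\sum_(i in coline (sqnorm_det3 x y z) a b) \sum_(j in coline (sqnorm_det3 x y z) a b)
      \sum_k triple_weight (sqnorm_det3 x y z) w i j k)
  <= 3 * (\sum_(i in coline (sqnorm_det3 x y z) a b) marginal (sqnorm_det3 x y z) w i) ^+ 2.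
Proof.
move=> w0 D0; set D := det3 x y z a b c in D0.
set d := sqnorm_det3 x y z; set L := coline d a b.
pose z' l := det3 x y z a b l.
pose T i j k := (w i)%:C%C * (w j)%:C%C * (w k)%:C%C * (D ^+ 2 * (D ^+ 2)^* * (d i j k)%:C%C).
have zL i : i \in L -> z' i = 0 by rewrite unfold_in sqnorm_det3_eq0 => /eqP.
have wC i : 0 <= (w i)%:C%C :> R[i] by rewrite ler0c.
have := hermitian_line_ineq (x := fun l => det3 x y z l b c)
  (y := fun l => det3 x y z a l c) wC zL (T := T).
have DD0 : 0 < D ^+ 2 * (D ^+ 2)^* by rewrite lt_def mul_conjC_ge0 mul_conjC_eq0 expf_neq0.
pose t i j k := triple_weight d w i j k.
have TE i j k : T i j k = D ^+ 2 * (D ^+ 2)^* * (t i j k)%:C%C.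
  by rewrite /T /t /triple_weight !rmorphM /=; ring.
have TEk i j : \sum_k T i j k = D ^+ 2 * (D ^+ 2)^* * (\sum_k t i j k)%:C%C.
  by rewrite rmorph_sum mulr_sumr; apply: eq_bigr => k _; rewrite TE.
have TEj (P : pred I) i : \sum_(j | P j) \sum_k T i j k =
    D ^+ 2 * (D ^+ 2)^* * (\sum_(j | P j) \sum_k t i j k)%:C%C.
  by rewrite rmorph_sum mulr_sumr; apply: eq_bigr => j _; rewrite TEk.
have TEi (P Q : pred I) : \sum_(i | Q i) \sum_(j | P j) \sum_k T i j k =
    D ^+ 2 * (D ^+ 2)^* * (\sum_(i | Q i) \sum_(j | P j) \sum_k t i j k)%:C%C.
  by rewrite rmorph_sum mulr_sumr; apply: eq_bigr => i _; rewrite TEj.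
rewrite !TEi => H; rewrite -lecR !rmorphM /= !rmorph_nat.
have {}H := H _; rewrite -(ler_pM2l DD0) -(ler_pM2l DD0).
set DD := D ^+ 2 * _ in H *.
rewrite [leLHS](_ : _ = 4 * (DD * (total d w)%:C%C) *
  (DD * (\sum_(i in L) \sum_(j in L) \sum_k t i j k)%:C%C)); last by ring.
rewrite [leRHS](_ : _ = 3 * (DD * (\sum_(i in L) marginal d w i)%:C%C) ^+ 2); last by ring.
apply: H => i j k; rewrite TE /t /triple_weight /DD det3_change_basis -/D.
by rewrite !rmorphM /= /d sqnorm_det3E; ring.
Qed.

(** * Summation over the lines *)

Definition line_geometry (R : comPzRingType) (I : eqType) (d : I -> I -> I -> R) :=
  forall i j k l, i != j -> k != l -> coline d i j k -> coline d i j l ->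
  coline d k l =1 coline d i j.

(** A line with [r] points arises from [r (r - 1)] ordered pairs [(i, j)], so the coefficient makes
    it count once, and each pair of distinct [k], [l] lies on exactly one line. *)
Lemma sum_pairs_by_line (R : realFieldType) (I : finType) (d : I -> I -> I -> R)
    (m : I -> I -> R) :
  sym_alternating d -> line_geometry d -> (forall k, m k k = 0) ->
  \sum_i \sum_(j | j != i) (#|coline d i j|%:R * (#|coline d i j|%:R - 1))^-1 *
    (\sum_(k in coline d i j) \sum_(l in coline d i j) m k l) = \sum_k \sum_l m k l.
Proof.
move=> altd geo m0; pose g i j : R := (#|coline d i j|%:R * (#|coline d i j|%:R - 1))^-1.
pose A i j k l := [&& j != i, coline d i j k & coline d i j l].
transitivity (\sum_(p : I * I) \sum_(q : I * I)
    (A p.1 p.2 q.1 q.2)%:R * g p.1 p.2 * m q.1 q.2).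
  rewrite -(pair_bigA _ (fun i j =>
    \sum_(q : I * I) (A i j q.1 q.2)%:R * g i j * m q.1 q.2)) /=.
  apply: eq_bigr => i _; rewrite big_mkcond /=; apply: eq_bigr => j _.
  rewrite -(pair_bigA _ (fun k l => (A i j k l)%:R * g i j * m k l)) /= /A.
  case: (j != i); last by rewrite big1 // => k _; rewrite big1 // => l _; rewrite !mul0r.
  rewrite mulr_sumr big_mkcond /=; apply: eq_bigr => k _.
  rewrite in_coline; case: (coline d i j k); last first.
    by rewrite big1 // => l _; rewrite !mul0r.
  rewrite /= mulr_sumr big_mkcond /=. apply: eq_bigr => l _.
  by rewrite in_coline; case: (coline d i j l); rewrite ?mul1r ?mul0r.
rewrite exchange_big [RHS]pair_bigA; apply: eq_bigr => -[k l] _ /=.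
have [->|kl] := eqVneq k l; first by rewrite m0 big1 // => p _; rewrite mulr0.
set L := coline d k l.
have AE (p : I * I) : (A p.1 p.2 k l)%:R * g p.1 p.2 * m k l =
    [&& L p.1, L p.2 & p.2 != p.1]%:R * (g k l * m k l).
  case: p => i j /=; rewrite /A; have [->|ji] /= := eqVneq j i.
    by rewrite !andbF !mul0r.
  rewrite andbT; have ij : i != j by rewrite eq_sym.
  have [iL jL] := coline_ends i j altd; have [kL lL] := coline_ends k l altd.
  have [/andP[Lk Ll]|no] := boolP (_ && _); last first.
    rewrite (_ : L i && L j = false) ?mul0r //; apply: contraNF no => /andP[Li Lj].
    by rewrite !(geo k l i j) // kL.
  have E := geo _ _ _ _ ij kl Lk Ll.
  by rewrite /L !E iL jL !mul1r /g (eq_card (B := coline d i j) E).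
under eq_bigr do rewrite AE.
rewrite -mulr_suml -(pair_bigA _ (fun i j => [&& L i, L j & j != i]%:R)) /=.
have r2 : (2 <= #|L|)%N by apply: card_coline.
have -> : \sum_i \sum_j [&& L i, L j & j != i]%:R = #|L|%:R * (#|L|%:R - 1) :> R.
  have -> : #|L|%:R * (#|L|%:R - 1) = \sum_(i in L) (#|L|%:R - 1) :> R.
    by rewrite sumr_const mulr_natl.
  rewrite [RHS]big_mkcond /=; apply: eq_bigr => i _.
  rewrite in_coline -[coline d k l i]/(L i).
  case Li : (L i) => /=; last by rewrite big1.
  have -> : #|L|%:R - 1 = #|[predD1 L & i]|%:R :> R.
    by rewrite (cardD1 i) [i \in L]Li natrD addrC addKr.
  rewrite -sum1_card natr_sum [RHS]big_mkcond /=; apply: eq_bigr => j _.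
  by rewrite !inE in_coline -[coline d k l j]/(L j); case: (L j); case: (j != i).
rewrite mulrA mulfV ?mul1r // mulf_neq0 // ?pnatr_eq0 -?lt0n ?(ltn_trans _ r2) //.
by rewrite gt_eqF // subr_gt0 ltr1n.
Qed.

(** Balance bounds the marginal sum of a line with [r] points by [r (3 + e) T / (3 n)]; this is put
    into the line inequalities, whose left sides sum to [4 T^2] over the lines. *)
Lemma balanced_weight_count (R : realFieldType) (I : finType) (d : I -> I -> I -> R)
    (w : I -> R) (e : R) :
  sym_alternating d -> line_geometry d -> (forall i j k, 0 <= d i j k) ->
  (forall i, 0 < w i) -> 0 < total d w -> 0 < e ->
  (forall i, #|I|%:R * (marginal d w i *+ 3) <= (3 + e) * total d w) ->
  (forall i j, i != j -> 4 * total d w *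
      (\sum_(k in coline d i j) \sum_(l in coline d i j) \sum_m triple_weight d w k l m)
    <= 3 * (\sum_(k in coline d i j) marginal d w k) ^+ 2) ->
  12 * #|I|%:R ^+ 2 <= (3 + e) ^+ 2 *
    \sum_i \sum_(j | j != i) #|coline d i j|%:R / (#|coline d i j|%:R - 1).
Proof.
move=> altd geo d0 w0 T0 e0 bal line; set n : R := #|I|%:R in bal *.
set T := total d w in T0 bal line.
have marg0 i : 0 <= marginal d w i.
  by do 2!apply: sumr_ge0 => ? _; rewrite /triple_weight !mulr_ge0 // ltW.
have [n0|nN0] := eqVneq n 0.
  rewrite n0 expr0n mulr0 mulr_ge0 ?sqr_ge0 // sumr_ge0 // => i _.
  rewrite sumr_ge0 // => j ji; rewrite divr_ge0 // subr_ge0 ler1n.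
  by apply: leq_trans (card_coline altd _); rewrite // eq_sym.
have npos : 0 < n by rewrite lt_def nN0 ler0n.
have TE : \sum_k \sum_l \sum_m triple_weight d w k l m = T by [].
rewrite -(@sum_pairs_by_line _ _ d) // in TE; last first.
  by move=> k; rewrite big1 // => l _; case: altd => _ _ dd; rewrite /triple_weight dd mulr0.
clearbody T.
have : 4 * T * T <= ((3 + e) ^+ 2 * T ^+ 2 / (3 * n ^+ 2)) *
    \sum_i \sum_(j | j != i) #|coline d i j|%:R / (#|coline d i j|%:R - 1).
  rewrite -{2}TE !mulr_sumr; apply: ler_sum => i _.
  rewrite !mulr_sumr; apply: ler_sum => j ji.
  have ij : i != j by rewrite eq_sym.
  have := line i j ij; have r2 := card_coline altd ij.
  set b := \sum_(k in _) \sum_(l in _) _; set a := \sum_(k in _) _.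
  set r := #|coline d i j|%:R.
  move=> ab; have r1 : 2 <= r by rewrite ler_nat.
  have a0 : 0 <= a by apply: sumr_ge0.
  have ar : a <= r * ((3 + e) * T / (3 * n)).
    rewrite /r mulr_natl -sumr_const; apply: ler_sum => k _.
    rewrite ler_pdivlMr ?mulr_gt0 //.
    by rewrite (_ : _ * (3 * n) = n * (marginal d w k *+ 3)) ?bal //; ring.
  have G0 : 0 < (r * (r - 1))^-1 by rewrite invr_gt0 mulr_gt0; lra.
  rewrite [leLHS](_ : _ = (r * (r - 1))^-1 * (4 * T * b)); last ring.
  apply: (@le_trans _ _ ((r * (r - 1))^-1 * (3 * (r * ((3 + e) * T / (3 * n))) ^+ 2))).
    rewrite ler_pM2l //; apply: le_trans ab _; rewrite ler_pM2l //.
    by apply: lerXn2r => //; rewrite nnegrE // (le_trans a0).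
  rewrite le_eqVlt; apply/orP; left; apply/eqP; field.
  by rewrite nN0 !gt_eqF //; lra.
set X := \sum_i _; have T2 : 0 < T ^+ 2 by rewrite exprn_gt0.
have n2 : 0 < 3 * n ^+ 2 by rewrite mulr_gt0 // exprn_gt0.
move=> H; rewrite -(ler_pM2l n2) in H; rewrite -(ler_pM2l T2).
rewrite [leLHS](_ : _ = 3 * n ^+ 2 * (4 * T * T)); last by ring.
by rewrite [leRHS](_ : _ = 3 * n ^+ 2 * ((3 + e) ^+ 2 * T ^+ 2 / (3 * n ^+ 2) * X)) //; field.
Qed.

(** * Langer's inequality for points of the plane *)

Definition orient (K : comPzRingType) (I : Type) (x y : I -> K) := det3 x y (fun=> 1).

(* Grassmann-Pluecker relation of [i], [j], [k], [l], [m] with the point at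
   infinity of a coordinate axis. *)
Lemma orient_geometry (K : fieldType) (I : eqType) (x y : I -> K) :
  (forall i j, i != j -> (x i, y i) != (x j, y j)) -> line_geometry (orient x y).
Proof.
move=> distinct i j k l ij kl; rewrite /coline => /eqP Dk /eqP Dl m.
pose D := orient x y i j m; pose E := orient x y k l m.
have px : (x l - x k) * D - (x j - x i) * E = 0.
  rewrite (_ : _ - _ = - (x m - x l) * orient x y i j k + (x m - x k) * orient x y i j l).
    by rewrite Dk Dl !mulr0 addr0.
  by rewrite /D /E /orient /det3; ring.
have py : (y l - y k) * D - (y j - y i) * E = 0.
  rewrite (_ : _ - _ = - (y m - y l) * orient x y i j k + (y m - y k) * orient x y i j l).
    by rewrite Dk Dl !mulr0 addr0.
  by rewrite /D /E /orient /det3; ring.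
have nz a b : a != b -> (x b - x a != 0) || (y b - y a != 0).
  by move/distinct; rewrite xpair_eqE negb_and !subr_eq0 [x b == _]eq_sym [y b == _]eq_sym.
change ((E == 0) = (D == 0)); apply/eqP/eqP => Z; move/eqP: px; move/eqP: py.
  rewrite Z !mulr0 !subr0 !mulf_eq0; have := nz k l kl.
  by case: (x l - x k == 0) => /= [/negPf-> /= /eqP|_ _ /eqP].
rewrite Z !mulr0 !sub0r !oppr_eq0 !mulf_eq0; have := nz i j ij.
by case: (x j - x i == 0) => /= [/negPf-> /= /eqP|_ _ /eqP].
Qed.

Lemma le_of_forall_eps (R : realFieldType) (A X : R) : 0 <= A -> 0 <= X ->
  (forall e, 0 < e -> 12 * A <= (3 + e) ^+ 2 * X) -> 4 * A <= 3 * X.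
Proof.
move=> A0 X0 H; rewrite leNgt; apply/negP => lt.
(* For [e <= 1] one has [(3 + e) ^+ 2 * X <= 9 * X + 7 * (e * X)], and
   [7 * (e * X) < e * D = 12 * A - 9 * X]; the other terms of [D] ensure [e <= 1]. *)
pose D := 7 * X + 12 * A + 1; have D0 : 0 < D by rewrite /D; lra.
pose e := (12 * A - 9 * X) / D.
have e0 : 0 < e by rewrite divr_gt0 //; lra.
have e1 : e <= 1 by rewrite ler_pdivrMr // /D; lra.
have eD : e * D = 12 * A - 9 * X by rewrite divfK // gt_eqF.
clearbody e.
have := H e e0; apply/negP; rewrite -ltNge.
apply: (@le_lt_trans _ _ (9 * X + 7 * (e * X))).
  rewrite -subr_ge0 (_ : _ - _ = e * X * (1 - e)); last ring.
  by rewrite !mulr_ge0 ?subr_ge0 // ?ltW.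
have : e * D = 7 * (e * X) + 12 * (e * A) + e by rewrite /D; ring.
have : 0 <= e * A by rewrite mulr_ge0 // ltW.
lra.
Qed.

(* A line with [r] points contributes [r ^ 2] to the double sum. *)
Lemma langer_inequality (R : archiRcfType) (K : numFieldType) (I : finType) (x y : I -> K) :
  (forall i j, i != j -> (x i, y i) != (x j, y j)) -> (3 <= #|I|)%N ->
  (forall i j, i != j -> (3 * #|coline (orient x y) i j| <= 2 * #|I|)%N) ->
  4 * #|I|%:R ^+ 2 <= 3 * \sum_i \sum_(j | j != i)
    #|coline (orient x y) i j|%:R / (#|coline (orient x y) i j|%:R - 1) :> R.
Proof.
move=> distinct n3 few.
have [X [Y XY]] := specialize_configuration (complex R) x y.
pose d := sqnorm_det3 X Y (fun=> 1).
have dE i j : coline d i j =1 coline (orient x y) i j.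
  by move=> k; rewrite /coline sqnorm_det3_eq0 XY.
have cE i j : #|coline d i j| = #|coline (orient x y) i j| by apply: eq_card => k; apply: dE.
have geo : line_geometry d.
  move=> i j k l ij kl; rewrite !dE => Lk Ll m; rewrite !dE.
  by rewrite (orient_geometry distinct ij kl Lk Ll).
have altd : sym_alternating d by apply: sqnorm_det3_alternating.
have d0 i j k : 0 <= d i j k by apply: sqnorm_det3_ge0.
have [|delta delta0 cap] := total_capacity altd d0 n3.
  by move=> i j ij; have := few i j ij; rewrite -cE.
apply: le_of_forall_eps => [||e e0]; first by rewrite sqr_ge0.
  do 2!apply: sumr_ge0 => ? ?; rewrite divr_ge0 // subr_ge0 ler1n -cE.
  by apply: leq_trans (card_coline altd _); rewrite // eq_sym.
have [w w0 bal] := exists_balanced_weight altd d0 delta0 e0 cap.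
have T0 : 0 < total d w.
  have : 0 < total d w ^+ #|I|.
    apply: lt_le_trans (cap w w0); rewrite mulr_gt0 // prodr_gt0 // => i _.
    by rewrite exprn_gt0.
  have [-> //|nz] := eqVneq (total d w) 0; last first.
    move=> _; rewrite lt_def nz; do 3!apply: sumr_ge0 => ? _.
    by rewrite /triple_weight !mulr_ge0 // ltW.
  by rewrite expr0n; case: #|I| n3 => //= n _; rewrite ltxx.
under eq_bigr do under eq_bigr do rewrite -cE.
apply: (balanced_weight_count altd geo d0 w0 T0 e0 bal) => i j ij.
have [c cL] : exists c, c \in predC (coline d i j).
  apply/card_gt0P; rewrite -(ltn_add2l #|coline d i j|) addn0 cardC.
  by have := few i j ij; rewrite -cE; move: n3; lia.
apply: (line_ineq (c := c)) => [k|]; first by rewrite ltW.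
by rewrite -sqnorm_det3_eq0.
Qed.

(** * Lines through a list of points *)

Lemma on_line_through (R : realFieldType) (A B C : point R) : A != B ->
  on_line C (line_through A B) =
  ((B.1 - A.1) * (C.2 - A.2) - (C.1 - A.1) * (B.2 - A.2) == 0).
Proof.
case: A B C => [a1 a2] [b1 b2] [c1 c2]; rewrite xpair_eqE negb_and /line_through /=.
have [e|ne] /= := eqVneq (b2 - a2) 0 => [|_].
  have /eqP := e; rewrite subr_eq0 => /eqP ->; rewrite eqxx orbF => ab.
  have ab' : a1 - b1 != 0 by rewrite subr_eq0.
  rewrite mul0r subrr mulr0 subr0 !add0r !mul0r add0r mulrAC divff // !mul1r.
  rewrite mulf_eq0 !subr_eq0 [b1 == _]eq_sym (negPf ab) //.
rewrite -subr_eq0 -(inj_eq (mulfI ne)) mulr0 -[RHS]oppr_eq0; congr (_ == 0).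
by field.
Qed.

Lemma line_through_eq (R : realFieldType) (A B C : point R) : A != B -> A != C ->
  (line_through A B == line_through A C) = on_line C (line_through A B).
Proof.
move=> AB AC; apply/eqP/idP => [->|].
  by rewrite on_line_through // subr_eq0 mulrC.
rewrite on_line_through // subr_eq0 => /eqP; move: AB AC.
case: A B C => [a1 a2] [b1 b2] [c1 c2]; rewrite !xpair_eqE !negb_and /line_through /=.
have aux0 (u v : R) : u = 0 -> v != 0 -> (u * a1 + v * a2) / v = a2.
  by move=> -> v0; field.
have [e|ne] /= := eqVneq (b2 - a2) 0.
  have /eqP := e; rewrite subr_eq0 => /eqP b2E; rewrite e b2E eqxx orbF mulr0 => ab ac.
  move/eqP; rewrite mulf_eq0 subr_eq0 [b1 == _]eq_sym (negPf ab) /= => /eqP ca.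
  rewrite ca eqxx /= !aux0 ?subrr // subr_eq0 //.
  by move/eqP: ca ac; rewrite subr_eq0 => /eqP ->; rewrite eqxx orbF.
move=> _ ac E.
have [e|ne'] /= := eqVneq (c2 - a2) 0.
  have /eqP := E; rewrite e mulr0 eq_sym mulf_eq0 (negPf ne) orbF subr_eq0 => /eqP ca.
  by move/eqP: e; rewrite subr_eq0 => /eqP ca2; move: ac; rewrite ca ca2 !eqxx.
have slope : (a1 - b1) / (b2 - a2) = (a1 - c1) / (c2 - a2).
  apply/eqP; rewrite eqr_div //; apply/eqP.
  by rewrite -[a1 - b1]opprB -[a1 - c1]opprB !mulNr E.
congr (_, _, _) => //.
have aux (u v : R) : v != 0 -> (v * a1 + u * a2) / v = a1 + u / v * a2.
  by move=> v0; field.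
by rewrite !aux // slope.
Qed.

Lemma incident_line_number_ge (R : realFieldType) (pts : seq (point R)) (P : point R)
    (s : seq (point R)) :
  P \in pts -> {subset s <= pts} -> P \notin s ->
  (size (undup [seq line_through P Q | Q <- s]) <= incident_line_number pts P)%N.
Proof.
move=> Pp sp Ps; rewrite /incident_line_number -size_filter.
apply: uniq_leq_size (undup_uniq _) _ => l; rewrite mem_undup => /mapP[Q Qs ->].
have PQ : P != Q by apply: contraNneq Ps => ->.
rewrite mem_filter on_line_through // !subrr mulr0 mul0r subrr eqxx /=.
rewrite mem_undup; apply/mapP; exists (P, Q) => //.
by rewrite mem_filter /= PQ; apply: allpairs_f => //; apply: sp.
Qed.

(** The members of a fiber contribute 1 together, so the sum counts the values of [f]. *)
Lemma sum_inv_card_fiber (F : numFieldType) (I : finType) (T : eqType) (f : I -> T)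
    (P : pred I) :
  \sum_(i | P i) (#|[pred k | P k && (f k == f i)]|%:R)^-1 =
  (size (undup [seq f i | i <- enum P]))%:R :> F.
Proof.
pose s := [seq f i | i <- enum P].
have cnt i : #|[pred k | P k && (f k == f i)]| = count_mem (f i) s.
  rewrite count_map /enum_mem cardE /enum_mem size_filter count_filter.
  by apply: eq_count => k /=; rewrite andbC.
rewrite -big_enum /=; under eq_bigr do rewrite cnt.
rewrite -(big_map f predT (fun l => ((count_mem l s)%:R)^-1)) -/s.
rewrite -big_undup_iterop_count -sum1_size natr_sum !big_seq.
apply: eq_bigr => l; rewrite mem_undup -/(GRing.natmul _ _) => ls.
rewrite -[LHS]mulr_natl mulfV // pnatr_eq0 -lt0n -has_count.
by apply/hasP; exists l => /=.
Qed.

Lemma natS_div (F : numFieldType) (m : nat) : (0 < m)%N ->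
  m.+1%:R / (m.+1%:R - 1) = 1 + m%:R^-1 :> F.
Proof.
by move=> m0; rewrite -natr1 addrK mulrDl divff ?mul1r // pnatr_eq0 -lt0n.
Qed.

(** If always [3 * D i <= n + 2], each term [3 * (n.-1 + D i)] is at most [4 * n - 1], and the sum
    stays below [4 * n ^ 2]. *)
Lemma dirac_of_incidence_sum (n : nat) (D : 'I_n -> nat) : (0 < n)%N ->
  (4 * n ^ 2 <= 3 * \sum_i (n.-1 + D i))%N -> exists i, (n + 3 <= 3 * D i)%N.
Proof.
move=> n0 H; apply/existsP; apply: contraLR H.
rewrite negb_exists => /forallP small; rewrite -ltnNge big_distrr /=.
have : (\sum_i 3 * (n.-1 + D i) <= \sum_(i < n) (4 * n - 1))%N.
  by apply: leq_sum => i _; have := small i; lia.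
rewrite sum_nat_const card_ord => h; apply: leq_ltn_trans h _.
by rewrite mulnC; nia.
Qed.

Theorem mainTheorem1 (R : realFieldType) (n : nat) (pts : seq (point R)) :
  (3 <= n)%N -> uniq pts -> size pts = n -> ~ all_collinear pts ->
  exists2 P, P \in pts &
    ((n + 2) %/ 3 + 1 <= incident_line_number pts P)%N.
Proof.
move=> n3 uniq_pts size_pts ncol.
pose P (i : 'I_n) : point R := nth (0, 0) pts i.
have Pin i : P i \in pts by rewrite mem_nth // size_pts.
have Pinj : injective P.
  by move=> i j /eqP; rewrite nth_uniq ?size_pts // => /eqP/val_inj.
have PN i j : i != j -> P i != P j by apply: contra_neq => /Pinj.
pose x i := (P i).1; pose y i := (P i).2.
have distinct i j : i != j -> (x i, y i) != (x j, y j).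
  by move/PN; rewrite /x /y; case: (P i); case: (P j).
have geo := orient_geometry distinct.
pose f i k := line_through (P i) (P k).
pose L i j := coline (orient x y) i j.
have fL i j k : i != j -> on_line (P k) (f i j) = L i j k.
  move=> ij; rewrite on_line_through ?PN // /L /coline /orient /det3 /x /y.
  by congr (_ == 0); ring.
have off_line i j : i != j -> exists k, ~~ L i j k.
  move=> ij; apply/existsP; rewrite -negb_forall; apply/negP => /forallP all.
  apply: ncol; exists (y j - y i), (x i - x j), ((y j - y i) * x i + (x i - x j) * y i).
  split=> [|Q Qp].
    have := distinct i j ij; rewrite xpair_eqE negb_and => /orP[xij|yij].
      by right; rewrite subr_eq0.
    by left; rewrite subr_eq0 eq_sym.
  have Qn : (index Q pts < n)%N by rewrite -size_pts index_mem.
  have <- : P (Ordinal Qn) = Q by rewrite /P nth_index.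
  have /eqP := all (Ordinal Qn); rewrite /orient /det3 -/(x _) -/(y _) => E.
  apply/eqP; rewrite -subr_eq0 -oppr_eq0 -[X in _ == X]E; apply/eqP; ring.
pose D i (s : seq 'I_n) := size (undup [seq f i k | k <- s]).
have DP i s : i \notin s -> (D i s <= incident_line_number pts (P i))%N.
  move=> iN; rewrite /D (_ : [seq f i k | k <- s] =
      [seq line_through (P i) Q | Q <- [seq P k | k <- s]]); last by rewrite -map_comp.
  apply: incident_line_number_ge => // [Q /mapP[k _ ->] //|].
  by rewrite mem_map.
(* A point off a line with more than [2n/3] points is joined to these by distinct lines, which are
   already enough. *)
have [/existsP[i /existsP[j /andP[ij big]]]|few] :=
    boolP [exists i, exists j, (i != j) && (2 * n < 3 * #|L i j|)%N].
  have [k kL] := off_line i j ij.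
  exists (P k) => //; apply: leq_trans (DP k (enum (L i j)) _); last first.
    by rewrite mem_enum.
  rewrite /D undup_id ?size_map -?cardE; first by move: n3 big; case: #|L i j| => [|r]; lia.
  rewrite map_inj_in_uniq ?enum_uniq // => a b; rewrite !mem_enum => La Lb /eqP.
  apply: contraTeq => ab.
  have [ka kb] : k != a /\ k != b by split; apply: contraNneq kL => ->.
  rewrite line_through_eq ?PN // -/(f k a) fL //; apply: contra kL => Lkab.
  have [E1 E2] : coline (orient x y) k a k /\ coline (orient x y) k a a.
    by rewrite /coline /orient /det3; split; apply/eqP; ring.
  rewrite -[L i j k](geo _ _ _ _ ij ab La Lb).
  rewrite (geo k a a b) //.
have {}few i j : i != j -> (3 * #|L i j| <= 2 * #|'I_n|)%N.
  move=> ij; rewrite card_ord leqNgt; apply: contra few => big.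
  by apply/existsP; exists i; apply/existsP; exists j; rewrite ij.
have nI : (3 <= #|'I_n|)%N by rewrite card_ord.
(* The weights live in the real algebraic numbers, archimedean and real closed, whatever the field
   [R] is. *)
have := langer_inequality realalg distinct nI few.
(* On a line with [r] points, [r / (r - 1) = 1 + 1 / (r - 1)], and its [r - 1] points other than [i]
   form a fiber of [f i]. *)
have sumE i : \sum_(j | j != i) #|L i j|%:R / (#|L i j|%:R - 1) =
    (n.-1 + D i (enum (predC1 i)))%:R :> realalg.
  rewrite natrD /D -(sum_inv_card_fiber _ (f i) (predC1 i)).
  have -> : n.-1%:R = \sum_(j | j != i) 1 :> realalg.
    by rewrite sumr_const cardC1 card_ord.
  rewrite -big_split; apply: eq_bigr => j ji /=.
  have ij : i != j by rewrite eq_sym.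
  have -> : #|L i j| = (#|[pred k | (k != i) && (f i k == f i j)]|).+1.
    rewrite (cardD1 i); have -> : i \in L i j.
      by rewrite in_coline /coline /orient /det3; apply/eqP; ring.
    congr _.+1; apply: eq_card => k; rewrite !inE; have [//|ki] /= := eqVneq k i.
    by rewrite eq_sym line_through_eq ?PN // 1?eq_sym // -/(f i j) fL.
  by apply: natS_div; apply/card_gt0P; exists j; rewrite inE ji eqxx.
rewrite (eq_bigr _ (fun i _ => sumE i)) card_ord -natr_sum -natrX -!natrM ler_nat.
move/(dirac_of_incidence_sum (leq_trans _ n3)) => [//|i Di].
exists (P i) => //; apply: leq_trans (DP i (enum (predC1 i)) _).
  (* [(n + 2) %/ 3] is the ceiling of [n/3], so [n + 3 <= 3 * D] rounds to the claim. *)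
  by move: Di; case: (D _ _) => [|r]; lia.
by rewrite mem_enum inE eqxx.
Qed.
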